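(* Let $(V,\Omega)$ be a real symplectic vector space of dimension $6$ and let $\omega\in\Lambda^3(V^* )$ be an effective $3$-form, i.e. $\omega\wedge\Omega=0$. Then for all $X,Y\in V$, $$ \Omega(K_\omega X,Y)=q_\omega(X,Y). $$
   Context: Fix the volume form $\theta=-\frac{\Omega^3}{6}$ on $V$. Let $A:\Lambda^5(V^* )\to V\otimes\Lambda^6(V^* )$ be the isomorphism induced by the exterior product: $A(\sigma)=Y\otimes\theta$, where $\eta\wedge\sigma=\eta(Y)\,\theta$ for all $\eta\in V^*$. The endomorphism $K_\omega:V\to V$ is defined by $K_\omega(X)\otimes\theta=A(i_X\omega\wedge\omega)$. Let $\Gamma:V\to V^*$, $X\mapsto i_X\Omega$, be the isomorphism induced by $\Omega$, and let $X_\Omega\in\Lambda^2(V)$ be the unique bivector whose image under the exterior power of $\Gamma$ is $\Omega$; in a symplectic basis $(e_1,e_2,e_3,f_1,f_2,f_3)$ with $\Omega=\sum_j e_j^*\wedge f_j^*$ one has $X_\Omega=\sum_j e_j\wedge f_j$. The operator $\bot:\Lambda^k(V^* )\to\Lambda^{k-2}(V^* )$ is contraction with $X_\Omega$, normalized so that $\bot(e_1^*\wedge f_1^* )=1$. The Lychagin-Roubtsov invariant is the quadratic form $$ q_\omega(X)=-\tfrac14\bot^2(i_X\omega\wedge i_X\omega), $$ and $q_\omega(X,Y)$ denotes the associated symmetric bilinear form given by its differential, $q_\omega(X,Y)=(dq_\omega)_X(Y)=q_\omega(X+Y)-q_\omega(X)-q_\omega(Y)$. *)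

(* Defs.v *)
From HB Require Import structures.
From mathcomp Require Import all_boot all_order all_algebra all_fingroup.
From mathcomp Require Import boolp classical_sets functions reals.

Set Implicit Arguments.
Unset Strict Implicit.
Unset Printing Implicit Defensive.

Import GRing.Theory Num.Theory.
Local Open Scope ring_scope.

(* Elements of Lambda^k(W^* ) are represented by alternating multilinear maps
   on k-tuples of vectors of W; the operations below are defined on arbitrary
   maps, and [altform] singles out the alternating multilinear ones. *)
Notation kform R W k := (k.-tuple W -> R^o).

Notation dualv R W := ('Hom(W, R^o)).

Section Forms.
Variables (R : realType) (W : vectType R).

Definition set_tnth k (v : k.-tuple W) (i : 'I_k) (x : W) : k.-tuple W :=
  [tuple if j == i then x else tnth v j | j < k].

Definition multilinear k (a : kform R W k) : Prop :=
  forall (v : k.-tuple W) (i : 'I_k) (c : R) (x y : W),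
    a (set_tnth v i (c *: x + y)) =
    c * a (set_tnth v i x) + a (set_tnth v i y).

Definition alternating k (a : kform R W k) : Prop :=
  forall (v : k.-tuple W) (i j : 'I_k),
    i != j -> tnth v i = tnth v j -> a v = 0.

Definition altform k (a : kform R W k) : Prop :=
  multilinear a /\ alternating a.

(* Determinant convention: (xi /\ eta)(x, y) = xi(x) eta(y) - xi(y) eta(x)
   for covectors xi and eta. *)
Definition wedge k l (a : kform R W k) (b : kform R W l) : kform R W (k + l) :=
  fun v => (k`! * l`!)%:R^-1 *
    \sum_(s : 'S_(k + l)) (-1) ^+ s *
      a [tuple tnth v (s (lshift l i)) | i < k] *
      b [tuple tnth v (s (rshift k j)) | j < l].

Definition inter k (X : W) (a : kform R W k.+1) : kform R W k :=
  fun v => a [tuple of X :: v].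

Definition form1 (xi : dualv R W) : kform R W 1 := fun v => xi (thead v).

Lemma wedge_form1 (xi eta : dualv R W) (x y : W) :
  wedge (form1 xi) (form1 eta) [tuple x; y] = xi x * eta y - xi y * eta x.
Proof.
have S2 : perm_eq (index_enum [the finType of 'S_2]) [:: 1%g; tperm ord0 ord_max].
  apply: uniq_perm; first exact: index_enum_uniq.
    rewrite /= inE andbT eq_sym; apply/eqP => /permP /(_ ord0).
    by rewrite tpermL perm1.
  move=> s; rewrite mem_index_enum !inE; apply/esym/orP.
  have ne (i j : 'I_2) : i != j -> s i != s j by rewrite (inj_eq perm_inj).
  have o2 (i : 'I_2) : (i == ord0) || (i == ord_max) by case: i => [[|[|//]]].
  have := ne ord0 ord_max isT.
  case/orP: (o2 (s ord0)) => /eqP E0; case/orP: (o2 (s ord_max)) => /eqP E1;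
    rewrite E0 E1 // => _; [left|right]; apply/eqP/permP => i;
    by case/orP: (o2 i) => /eqP ->; rewrite ?perm1 ?tpermL ?tpermR.
rewrite /wedge (perm_big _ S2) /= !big_cons big_nil invr1 mul1r addr0.
have lr : lshift 1 (@ord0 0) = @ord0 1 by exact/val_inj.
have rr : rshift 1 (@ord0 0) = @ord_max 1 by exact/val_inj.
rewrite odd_perm1 odd_tperm /= expr0 expr1 /form1 /thead !tnth_mktuple lr rr.
by rewrite !perm1 tpermL tpermR mul1r mulN1r mulNr (mulrC (xi y)) [eta x * _]mulrC.
Qed.

End Forms.

Section Bivectors.
Variables (R : realType) (V : vectType R).

(* Lambda^2(V) is the space of alternating bilinear forms on V^*, a bivector
   x /\ y being the form (xi, eta) |-> xi(x) eta(y) - xi(y) eta(x). *)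
Notation bivector := (kform R (dualv R V) 2).

Definition wedge_vec (x y : V) : bivector := fun xi =>
  tnth xi ord0 x * tnth xi ord_max y - tnth xi ord0 y * tnth xi ord_max x.

(* The image of a bivector under Lambda^2(G) : Lambda^2(V) -> Lambda^2(V^* ),
   for a linear map G : V -> V^*; see [bivector_image_wedge]. *)
Definition bivector_image (G : V -> dualv R V) (B : bivector) : kform R V 2 :=
  fun v => B [tuple linfun (fun x => G x (tnth v i) : R^o) | i < 2].

Definition dual_basis (i : 'I_(\dim {:V})) : dualv R V :=
  linfun (coord (vbasis {:V}) i : V -> R^o).

(* Contraction with B = 1/2 \sum_(i, j) B(b_i^*, b_j^* ) b_i /\ b_j, where
   contraction with x /\ y is i_y \o i_x; see [contract_wedge]. *)
Definition contract k (B : bivector) (a : kform R V k.+2) : kform R V k :=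
  2%:R^-1 *: \sum_(i < \dim {:V}) \sum_(j < \dim {:V})
    B [tuple dual_basis i; dual_basis j] *:
      inter (vbasis {:V})`_j (inter (vbasis {:V})`_i a).

Lemma bivector_image_wedge (G : {linear V -> dualv R V}) (x y u v : V) :
  bivector_image G (wedge_vec x y) [tuple u; v] =
    wedge (form1 (G x)) (form1 (G y)) [tuple u; v].
Proof.
rewrite wedge_form1 /bivector_image /wedge_vec !tnth_mktuple.
have lG (z : V) : linear (fun t => G t z : R^o).
  by move=> c a b; rewrite linearP /= !lfunE /= !lfunE.
pose g z : {linear V -> R^o} :=
  HB.pack (fun t => G t z : R^o) (GRing.isLinear.Build _ _ _ _ _ (lG z)).
have E (z t : V) : linfun (fun t => G t z : R^o) t = G t z.
  by rewrite (lfunE (g z)).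
by rewrite !E /= (mulrC (G y u)).
Qed.

Lemma contract_wedge k (x y : V) (a : kform R V k.+2) :
  altform a -> contract (wedge_vec x y) a = inter y (inter x a).
Proof.
move=> [mula alta]; apply/funext => v.
pose b i := (vbasis {:V})`_i.
pose f s t := a [tuple of s :: [tuple of t :: v]].
have fl t c s s' : f (c *: s + s') t = c * f s t + f s' t.
  have E z : [tuple of z :: [tuple of t :: v]] =
      set_tnth [tuple of 0 :: [tuple of t :: v]] ord0 z.
    apply: eq_from_tnth => i; rewrite tnth_mktuple.
    by case: (unliftP ord0 i) => [j|] ->; rewrite ?tnth0 // !tnthS.
  by rewrite /f E mula -!E.
have fr s c t t' : f s (c *: t + t') = c * f s t + f s t'.
  pose i1 : 'I_k.+2 := lift ord0 ord0.
  have E z : [tuple of s :: [tuple of z :: v]] =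
      set_tnth [tuple of s :: [tuple of 0 :: v]] i1 z.
    apply: eq_from_tnth => i; rewrite tnth_mktuple /i1.
    case: (unliftP ord0 i) => [j|] ->; rewrite ?tnth0 // !tnthS.
    rewrite (inj_eq lift_inj).
    by case: (unliftP ord0 j) => [l|] ->; rewrite ?tnth0 // !tnthS.
  by rewrite /f E mula -!E.
have f_id s : f s s = 0.
  by apply: (alta _ ord0 (lift ord0 ord0)) => //; rewrite tnthS !tnth0.
have fZ t s c : f (c *: s) t = c * f s t.
  have f0 : f 0 t = 0.
    by have /eqP := fl t 1 0 0; rewrite scaler0 addr0 mul1r -subr_eq subrr => /eqP.
  by rewrite -[c *: s]addr0 fl f0 addr0.
have fD t s s' : f (s + s') t = f s t + f s' t.
  by rewrite -[s]scale1r fl mul1r scale1r.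
have fNC s t : f t s = - f s t.
  apply/eqP; rewrite -addr_eq0; apply/eqP.
  have := f_id (s + t); rewrite fD -[X in f s (_ + X)]addr0.
  rewrite addr0 -[X in f s (X + _)]scale1r -[X in f t (X + _)]scale1r !fr.
  by rewrite !f_id !mul1r add0r addr0 addrC.
have f0 t : f 0 t = 0 by rewrite -(scale0r 0) fZ mul0r.
have fsum x' t : f x' t = \sum_i dual_basis i x' * f (b i) t.
  have E := coord_vbasis (memvf x').
  rewrite [in LHS]E (big_morph (f^~ t) (fD t) (f0 t)); apply: eq_bigr => i _.
  by rewrite fZ /dual_basis lfunE.
have fsum2 x' y' : f x' y' =
    \sum_i \sum_j dual_basis i x' * dual_basis j y' * f (b i) (b j).
  rewrite fsum; apply: eq_bigr => i _.
  rewrite fNC fsum -sumrN mulr_sumr; apply: eq_bigr => j _.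
  by rewrite -mulrN -fNC mulrA.
have -> : contract (wedge_vec x y) a v = 2%:R^-1 * (f x y - f y x).
  rewrite /contract; congr (_ * _); rewrite fct_sumE !fsum2 -sumrB.
  apply: eq_bigr => i _; rewrite fct_sumE -sumrB; apply: eq_bigr => j _.
  by rewrite -mulrBl.
by rewrite (fNC x y) opprK -mulr2n -[f x y *+ 2]mulr_natl mulKf ?pnatr_eq0.
Qed.

End Bivectors.

Section Symplectic.
Variables (R : realType) (V : vectType R).
Implicit Types (Omega : kform R V 2) (omega : kform R V 3).

Definition nondegenerate Omega : Prop :=
  forall X : V, (forall Y : V, Omega [tuple X; Y] = 0) -> X = 0.

Definition symplectic Omega : Prop := altform Omega /\ nondegenerate Omega.

Definition effective Omega omega : Prop := wedge omega Omega = 0.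

Definition volume Omega : kform R V 6 :=
  - (6%:R^-1 *: wedge Omega (wedge Omega Omega)).

(* The vector Y such that A(sigma) = Y (x) theta, that is, A followed by the
   identification of V (x) Lambda^6(V^* ) with V given by the generator theta
   of the line Lambda^6(V^* ); it exists and is unique for alternating sigma and
   theta with theta <> 0 when \dim V = 6. *)
Definition A_coef (theta : kform R V 6) (sigma : kform R V 5) : V :=
  xget 0 [set Y : V | forall eta : dualv R V,
                        wedge (form1 eta) sigma = eta Y *: theta]%classic.

Definition K_endo Omega omega (X : V) : V :=
  A_coef (volume Omega) (wedge (inter X omega) omega).

Definition Gamma Omega (X : V) : dualv R V :=
  linfun (fun Y => inter X Omega [tuple Y] : R^o).

(* Exists and is unique for symplectic Omega, as Gamma is then an isomorphism;
   0 is a dummy value for the other forms. *)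
Definition X_Omega Omega : kform R (dualv R V) 2 :=
  xget 0 [set B | altform B /\ bivector_image (Gamma Omega) B = Omega]%classic.

Definition bot Omega k (a : kform R V k.+2) : kform R V k :=
  contract (X_Omega Omega) a.

(* Forms of degree 0 are identified with scalars by evaluation at the empty
   tuple. *)
Definition LR_form Omega omega (X : V) : R :=
  - (4%:R^-1 * bot Omega (bot Omega (wedge (inter X omega) (inter X omega)))
                 [tuple]).

Definition LR_polar Omega omega (X Y : V) : R :=
  LR_form Omega omega (X + Y) - LR_form Omega omega X - LR_form Omega omega Y.

End Symplectic.

(* Main.v *)
From HB Require Import structures.
Require Import Defs.
From mathcomp Require Import all_boot all_order all_algebra all_fingroup.
From mathcomp Require Import boolp classical_sets functions reals.
From mathcomp Require Import ring zify.
Set Implicit Arguments.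
Unset Strict Implicit.
Unset Printing Implicit Defensive.
Local Open Scope ring_scope.
Import GRing.Theory Num.Theory.

(** Write a = i_X omega, b = i_Y omega and Z = K_omega X. Testing the definition
    of Z against the covector i_Y Omega gives

      Omega(Z, Y) Omega^3 / 6 = i_Y Omega /\ a /\ omega.

    Applying i_Y to Omega /\ omega = 0 yields i_Y Omega /\ omega = - Omega /\ b
    ([effective_hook]), so the right-hand side is - Omega /\ a /\ b. Polarizing
    the quadratic form gives q_omega(X, Y) = - bot^2(a /\ b) / 2 ([LR_polarE]).
    It remains to compare Omega /\ t with bot^2 t for the 4-form t = a /\ b.

    This, the nonvanishing of the volume form and the existence of Z all follow
    from the Lefschetz relation [bot, Omega /\ _] = 3 - k on k-forms
    ([lefschetz_comm]). The relation gives
    bot^3(Omega /\ t) = 3 bot^2 t for 4-forms ([ctr3_L]) and bot^3(Omega^3) = 36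
    ([ctr3_O3]), so applying bot^3 to the identity above finishes the proof.
    Since forms of degree 8 vanish, it also gives 36 s = bot^3(s) Omega^3 for
    every 6-form s ([top_form]); hence eta /\ sigma is a multiple of Omega^3 that
    depends linearly on eta, which is the existence of the vector representing
    a 5-form sigma ([A_coefP]).

    The relation itself is a computation with interior products, so the exterior
    algebra is developed on functions of lists, with a product defined by the
    antiderivation rule ([shuffle]): associativity and graded commutativity are
    then short inductions. [lform_of_wedge] identifies that product with the
    normalized sum over all permutations. *)

(** * Functions on lists and their shuffle product *)

(** A form of any degree is a function of the list of its arguments, zero on
    lists of the wrong length: degrees then add up without casts between
    dependent types, and induction on the list is available. *)
Notation lform V R := (seq V -> R^o).

Section ShuffleProduct.
Variables (R : comNzRingType) (V : Type).
Implicit Types (a b c : lform V R) (x y : V) (u v w : seq V).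

(** The interior product i_x. *)
Definition hook x a : lform V R := fun v => a (x :: v).

(** The grading involution, (-1)^k on k-forms: the sign with which an
    antiderivation passes over its left factor. *)
Definition signed a : lform V R := fun v => (-1) ^+ size v * a v.

(** The exterior product, defined by the antiderivation rule
    i_x (a /\ b) = i_x a /\ b + (-1)^deg(a) a /\ i_x b
    read as a recursion on the list of arguments. Unfolded, it is the signed
    sum over the shuffles of the arguments. *)
Fixpoint shuffle a b v {struct v} : R^o :=
  if v is x :: v'
  then shuffle (hook x a) b v' + shuffle (signed a) (hook x b) v'
  else a [::] * b [::].

Lemma hook_shuffle x a b :
  hook x (shuffle a b) = shuffle (hook x a) b + shuffle (signed a) (hook x b).
Proof. by []. Qed.

Lemma hook_signed x a : hook x (signed a) = - signed (hook x a).
Proof. by apply/funext => v; rewrite /hook /signed /= exprS !mulN1r mulNr. Qed.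

Lemma hookP x k a b : hook x (k *: a + b) = k *: hook x a + hook x b.
Proof. by []. Qed.

Lemma hookD x a b : hook x (a + b) = hook x a + hook x b.
Proof. by []. Qed.

Lemma signedP k a b : signed (k *: a + b) = k *: signed a + signed b.
Proof.
apply/funext => v.
by rewrite /signed [LHS]mulrDr -[(k *: a) v]/(k * a v) mulrCA.
Qed.

Lemma lformD a b v : (a + b) v = a v + b v. Proof. by []. Qed.
Lemma lformN a v : (- a) v = - a v. Proof. by []. Qed.
Lemma lformZ k a v : (k *: a) v = k * a v. Proof. by []. Qed.
Definition lformE := (lformD, lformN, lformZ).

Lemma shufflePl k a b c : shuffle (k *: a + b) c = k *: shuffle a c + shuffle b c.
Proof.
apply/funext => v; elim: v a b c => [|x v IH] a b c; rewrite !lformE /= ?lformE.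
  by ring.
by rewrite hookP signedP !IH !lformE; ring.
Qed.

Lemma shufflePr k a b c : shuffle a (k *: b + c) = k *: shuffle a b + shuffle a c.
Proof.
apply/funext => v; elim: v a b c => [|x v IH] a b c; rewrite !lformE /= ?lformE.
  by ring.
by rewrite hookP !IH !lformE; ring.
Qed.

Lemma shuffle0l a : shuffle 0 a = 0.
Proof. by have := shufflePl (-1) 0 0 a; rewrite scaler0 addr0 scaleN1r addNr. Qed.

Lemma shuffle0r a : shuffle a 0 = 0.
Proof. by have := shufflePr (-1) a 0 0; rewrite scaler0 addr0 scaleN1r addNr. Qed.

Lemma shuffleDl a b c : shuffle (a + b) c = shuffle a c + shuffle b c.
Proof. by rewrite -[a]scale1r shufflePl !scale1r. Qed.

Lemma shuffleDr a b c : shuffle a (b + c) = shuffle a b + shuffle a c.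
Proof. by rewrite -[b]scale1r shufflePr !scale1r. Qed.

Lemma shuffleZl k a b : shuffle (k *: a) b = k *: shuffle a b.
Proof. by rewrite -[k *: a]addr0 shufflePl shuffle0l addr0. Qed.

Lemma shuffleZr k a b : shuffle a (k *: b) = k *: shuffle a b.
Proof. by rewrite -[k *: b]addr0 shufflePr shuffle0r addr0. Qed.

Lemma shuffleNl a b : shuffle (- a) b = - shuffle a b.
Proof. by rewrite -scaleN1r shuffleZl scaleN1r. Qed.

Lemma shuffleNr a b : shuffle a (- b) = - shuffle a b.
Proof. by rewrite -scaleN1r shuffleZr scaleN1r. Qed.

Lemma shuffle_suml (I : finType) (F : I -> lform V R) b :
  shuffle (\sum_i F i) b = \sum_i shuffle (F i) b.
Proof.
apply: (big_morph (fun a => shuffle a b)) => [x y|].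
  exact: shuffleDl.
exact: shuffle0l.
Qed.

Lemma shuffle_sumr (I : finType) a (F : I -> lform V R) :
  shuffle a (\sum_i F i) = \sum_i shuffle a (F i).
Proof. exact: (big_morph (shuffle a) (shuffleDr a) (shuffle0r a)). Qed.

Lemma signed_shuffle a b : signed (shuffle a b) = shuffle (signed a) (signed b).
Proof.
apply/funext => v; elim: v a b => [|x v IH] a b.
  by rewrite /signed /= expr0 !mul1r.
rewrite [RHS]/= !hook_signed shuffleNl shuffleNr !lformE -!IH.
by rewrite /signed /= exprS; ring.
Qed.

(** Both sides satisfy the same three-term recursion, because [signed] is
    multiplicative. *)
Lemma shuffleA a b c : shuffle a (shuffle b c) = shuffle (shuffle a b) c.
Proof.
apply/funext => v; elim: v a b c => [|x v IH] a b c /=; first by rewrite mulrA.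
rewrite !hook_shuffle signed_shuffle shuffleDr shuffleDl !lformE !IH.
by rewrite addrA.
Qed.

(** Homogeneity enters only through the parities p and q of the degrees, which
    [hook] flips. *)
Lemma shuffleC (p q : bool) a b :
    signed a = (-1) ^+ p *: a -> signed b = (-1) ^+ q *: b ->
  shuffle a b = (-1) ^+ (p && q) *: shuffle b a.
Proof.
move=> pa qb; apply/funext => v.
elim: v p q a b pa qb => [|x v IH] p q a b pa qb.
  rewrite lformE /=; case: p pa => [pa|_]; case: q {qb} => /=; try by ring.
  have := congr1 (@^~ [::]) pa; rewrite lformE /signed /= expr0 mul1r => a0.
  by rewrite [in LHS]a0; ring.
rewrite /= lformE /=.
have hookS (r : bool) d : signed d = (-1) ^+ r *: d ->
    signed (hook x d) = (-1) ^+ (~~ r) *: hook x d.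
  move=> rd; rewrite -[LHS]opprK -hook_signed rd; apply/funext => u.
  by rewrite !lformE /hook lformE; case: (r); rewrite /= ?expr0 ?expr1; ring.
rewrite (IH _ _ _ _ (hookS _ _ pa) qb) pa shuffleZl !lformE.
rewrite (IH _ _ _ _ pa (hookS _ _ qb)) qb shuffleZl !lformE.
by case: (p) (q) => [] [] /=; rewrite ?expr0 ?expr1; ring.
Qed.

Lemma shuffle_scalar a b : (forall x, hook x a = 0) -> shuffle a b = a [::] *: b.
Proof.
move=> a0; apply/funext => v; elim: v a b a0 => [|x v IH] a b a0 //=.
have -> : signed a = a.
  apply/funext => -[|y u]; first by rewrite /signed expr0 mul1r.
  by rewrite /signed -[a (y :: u)]/(hook y a u) a0 mulr0.
by rewrite a0 shuffle0l lformE add0r IH.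
Qed.
End ShuffleProduct.

(** * Alternating multilinear functions on lists *)
Section Skew.
Variables (R : comNzRingType) (V : Type).
Implicit Types (a b c : lform V R) (x y : V) (u v w : seq V).

Definition antisym a :=
  forall u x y w, a (u ++ x :: y :: w) = - a (u ++ y :: x :: w).

Lemma antisym_move a u w x v : antisym a ->
  a (u ++ w ++ x :: v) = (-1) ^+ size w * a (u ++ x :: w ++ v).
Proof.
move=> sa; elim: w u => [|y w IH] u; first by rewrite expr0 mul1r.
rewrite /= -cat_rcons IH cat_rcons sa exprS; ring.
Qed.

End Skew.

Section AlternatingListForms.
Variables (R : numFieldType) (V : vectType R).
Implicit Types (a b c : lform V R) (x y : V) (u v w : seq V).

Definition mlinear a := forall u k x y w,
  a (u ++ (k *: x + y) :: w) = k * a (u ++ x :: w) + a (u ++ y :: w).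

Definition lalt a := antisym a /\ mlinear a.

Lemma lalt_hook x a : lalt a -> lalt (hook x a).
Proof.
move=> [sa ma]; split=> u.
  exact: (sa (x :: u)).
exact: (ma (x :: u)).
Qed.

Lemma lalt_signed a : lalt a -> lalt (signed a).
Proof.
move=> [sa ma]; split=> [u x y w|u k x y w]; rewrite /signed ?size_cat /=.
  by rewrite sa mulrN.
by rewrite ma; ring.
Qed.

Lemma laltD a b : lalt a -> lalt b -> lalt (a + b).
Proof.
move=> [sa ma] [sb mb]; split=> [u x y w|u k x y w]; rewrite !lformE.
  by rewrite sa sb opprD.
by rewrite ma mb; ring.
Qed.

Lemma laltZ k a : lalt a -> lalt (k *: a).
Proof.
move=> [sa ma]; split=> [u x y w|u l x y w]; rewrite !lformE.
  by rewrite sa mulrN.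
by rewrite ma; ring.
Qed.

Lemma lalt0 : lalt (0 : lform V R).
Proof.
split=> [u x y w|u l x y w]; first by rewrite -[RHS]/(- 0) oppr0.
by rewrite -[RHS]/(l * 0 + 0) mulr0 addr0.
Qed.

Lemma lalt_sum (I : finType) (F : I -> lform V R) :
  (forall i, lalt (F i)) -> lalt (\sum_i F i).
Proof.
by move=> altF; elim/big_rec: _ => [|i a _]; [exact: lalt0|exact: laltD].
Qed.

Lemma hook_hook x y a : lalt a -> hook x (hook y a) = - hook y (hook x a).
Proof. by move=> [sa _]; apply/funext => v; apply: (sa [::] y x v). Qed.

Lemma hook_linear k x y a : lalt a ->
  hook (k *: x + y) a = k *: hook x a + hook y a.
Proof. by move=> [_ ma]; apply/funext => v; apply: (ma [::]). Qed.

(** If one of the vectors compared is not at the head of the list, the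
    recursion defining the product reduces the claim to shorter lists; at the
    head, two steps of that recursion show the (anti)symmetric pattern. *)
Lemma lalt_shuffle a b : lalt a -> lalt b -> lalt (shuffle a b).
Proof.
move=> alta altb; split=> u.
  elim: u a b alta altb => [|z u IH] a b alta altb x y w.
    rewrite /= !hook_signed !shuffleNl !lformE.
    rewrite (hook_hook x y alta) (hook_hook x y altb).
    by rewrite shuffleNl shuffleNr !lformE; ring.
  rewrite /= (IH _ _ (lalt_hook z alta) altb).
  by rewrite (IH _ _ (lalt_signed alta) (lalt_hook z altb)) opprD.
elim: u a b alta altb => [|z u IH] a b alta altb k x y w.
  rewrite /= !hook_linear // shuffleDl shuffleDr shuffleZl shuffleZr !lformE.
  by ring.
rewrite /= (IH _ _ (lalt_hook z alta) altb).
by rewrite (IH _ _ (lalt_signed alta) (lalt_hook z altb)); ring.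
Qed.

Lemma lalt_mem a u x v : lalt a -> x \in v -> a (u ++ x :: v) = 0.
Proof.
move=> [sa _] /splitPr [v1 v2].
(* the two copies of x are made adjacent *)
rewrite -cat_rcons antisym_move // cat_rcons.
have /eqP := sa u x x (v1 ++ v2).
rewrite -addr_eq0 -mulr2n -mulr_natr mulf_eq0 pnatr_eq0 orbF => /eqP ->.
by rewrite mulr0.
Qed.

Lemma lalt_sumv a u w (I : finType) (c : I -> R) (F : I -> V) : lalt a ->
  a (u ++ (\sum_i c i *: F i) :: w) = \sum_i c i * a (u ++ F i :: w).
Proof.
move=> [_ ma].
have a0 : a (u ++ 0 :: w) = 0.
  have := ma u (-1) 0 0 w; rewrite scaler0 addr0 mulN1r => {1}->.
  by rewrite addNr.
elim/big_rec2: _ => [//|i y1 y2 _ <-]; exact: ma.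
Qed.

(** One vector is a combination of those that follow it; expanding it there
    leaves lists with a repeated entry. *)
Lemma lalt_dependent a u v : lalt a -> ~~ free v -> a (u ++ v) = 0.
Proof.
move=> alta; elim: v u => [|x v IH] u; first by rewrite nil_free.
rewrite free_cons negb_and negbK => /orP [xv|nfv]; last by rewrite -cat_rcons IH.
rewrite (@coord_span _ _ _ (in_tuple v) x xv) lalt_sumv //.
by rewrite big1 // => i _; rewrite lalt_mem ?mulr0 // mem_nth.
Qed.

Lemma lalt_above_dim a v : lalt a -> (\dim {:V} < size v)%N -> a v = 0.
Proof.
move=> alta dv; rewrite -[v]cat0s lalt_dependent //; apply: contraL dv => fv.
by rewrite -leqNgt -(eqP fv) dimvS // subvf.
Qed.

End AlternatingListForms.

(** * Contraction against the dual basis *)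
Section Euler.
Variables (R : numFieldType) (V : vectType R).
Implicit Types (a b c : lform V R) (x y : V) (u v w : seq V).

Definition covector (xi : V -> R) : lform V R :=
  fun v => if v is [:: x] then xi x else 0.

Definition bcoord (i : 'I_(\dim {:V})) : V -> R := coord (vbasis {:V}) i.
Definition bvec (i : 'I_(\dim {:V})) : V := (vbasis {:V})`_i.

Lemma bcoord_bvec i j : bcoord i (bvec j) = (i == j)%:R.
Proof. by rewrite /bcoord /bvec coord_free ?(basis_free (vbasisP _)) // eq_sym. Qed.

Lemma bvec_expand x : x = \sum_i bcoord i x *: bvec i.
Proof. exact: (coord_vbasis (memvf x)). Qed.

Lemma shuffle_hook_covector (xi : V -> R) x a :
  shuffle (hook x (covector xi)) a = xi x *: a.
Proof. by rewrite shuffle_scalar // => y; apply/funext. Qed.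

(** The Euler identity, sum_i e^i /\ i_(e_i) a = k a for a k-form a: the
    commutator of i_x with the left-hand operator is i_x, by the expansion of x
    in the basis, so each argument contributes one copy of a. The degree is
    read off as the length of the list. *)
Lemma euler a v : lalt a ->
  (\sum_i shuffle (covector (bcoord i)) (hook (bvec i) a)) v = (size v)%:R * a v.
Proof.
rewrite fct_sumE; elim: v a => [|x v IH] a alta.
  by rewrite mul0r big1 // => i _; rewrite /= mul0r.
rewrite /=.
have sg i : signed (covector (bcoord i)) = - covector (bcoord i).
  apply/funext => -[|y [|z u]]; rewrite !lformE /signed /= ?mulr0 ?oppr0 //.
  by rewrite expr1 mulN1r.
under eq_bigr => i _.
  rewrite shuffle_hook_covector sg shuffleNl hook_hook // shuffleNr opprK lformE.
  over.
rewrite big_split /= IH; last exact: lalt_hook.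
rewrite -(lalt_sumv [::] v _ _ alta) -bvec_expand /= /hook.
by rewrite mulrS; ring.
Qed.

End Euler.

(** * Homogeneous functions *)
Section Graded.
Variables (R : comNzRingType) (V : Type).
Implicit Types (a b c : lform V R) (x y : V) (u v w : seq V).

Definition homog (k : nat) a := forall v, size v != k -> a v = 0.

Lemma homog_hook k x a : homog k.+1 a -> homog k (hook x a).
Proof. by move=> ka v nv; apply: ka. Qed.

Lemma hook_homog0 x a : homog 0 a -> hook x a = 0.
Proof. by move=> a0; apply/funext => v; apply: a0. Qed.

Lemma homog_signed k a : homog k a -> signed a = (-1) ^+ odd k *: a.
Proof.
move=> ka; apply/funext => v; rewrite lformE /signed -signr_odd.
by have [<-//|/ka->] := eqVneq (size v) k; rewrite !mulr0.
Qed.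

Lemma homogD k a b : homog k a -> homog k b -> homog k (a + b).
Proof. by move=> ka kb v nv; rewrite lformE ka ?kb ?addr0. Qed.

Lemma homogZ k r a : homog k a -> homog k (r *: a).
Proof. by move=> ka v nv; rewrite lformE ka ?mulr0. Qed.

Lemma homog_sum k (I : finType) (F : I -> lform V R) :
  (forall i, homog k (F i)) -> homog k (\sum_i F i).
Proof. by move=> kF v nv; rewrite fct_sumE big1 // => i _; apply: kF. Qed.

Lemma homog_shuffle k l a b : homog k a -> homog l b -> homog (k + l) (shuffle a b).
Proof.
move=> ka lb v; elim: v k l a b ka lb => [|x v IH] k l a b ka lb.
  move=> nv /=; case: k ka nv => [|k] ka; last by rewrite ka ?mul0r.
  by case: l lb => [|l] lb // _; rewrite lb ?mulr0.
move=> nv /=; rewrite (homog_signed ka) shuffleZl lformE.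
have -> : shuffle (hook x a) b v = 0.
  case: k ka nv => [|k] ka nv; first by rewrite hook_homog0 // shuffle0l.
  by apply: (IH k l) => //; apply: homog_hook.
rewrite add0r; case: l lb nv => [|l] lb nv.
  by rewrite hook_homog0 // shuffle0r [X in _ * X]/0 mulr0.
rewrite (IH k l _ _ ka (homog_hook x lb)) ?mulr0 //.
by move: nv; rewrite addnS.
Qed.

Lemma shuffle_homogC k l a b : homog k a -> homog l b ->
  shuffle a b = (-1) ^+ (odd k && odd l) *: shuffle b a.
Proof. by move=> /homog_signed ka /homog_signed lb; apply: shuffleC. Qed.

Lemma shuffle_homog0 a b : homog 0 a -> shuffle a b = a [::] *: b.
Proof. by move=> a0; apply: shuffle_scalar => x; apply: hook_homog0. Qed.

End Graded.

(** * The Lefschetz commutation relation *)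

(** O is the symplectic form and B the matrix of its bivector in the basis
    [bvec]: [invB] says that B is minus the inverse of the matrix of O. *)
Section Lefschetz.
Variables (R : numFieldType) (V : vectType R).
Variables (O : lform V R) (B : 'I_(\dim {:V}) -> 'I_(\dim {:V}) -> R).
Hypotheses (altO : lalt O) (homO : homog 2 O).
Hypothesis (skewB : forall i j, B j i = - B i j).
Hypothesis (invB : forall i x, \sum_j B i j * O [:: bvec j; x] = - bcoord i x).
Implicit Types (a b c : lform V R) (x y : V) (u v w : seq V).

Definition ctr a : lform V R :=
  2%:R^-1 *: \sum_i \sum_j B i j *: hook (bvec j) (hook (bvec i) a).

Local Notation L := (shuffle O).

Lemma lalt_ctr a : lalt a -> lalt (ctr a).
Proof.
move=> alta; apply/laltZ/lalt_sum => i; apply: lalt_sum => j.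
by apply/laltZ/lalt_hook/lalt_hook.
Qed.

Lemma homog_ctr k a : homog k.+2 a -> homog k (ctr a).
Proof.
move=> ka; apply/homogZ/homog_sum => i; apply: homog_sum => j.
by apply/homogZ/homog_hook/homog_hook.
Qed.

Lemma ctrP k a b : ctr (k *: a + b) = k *: ctr a + ctr b.
Proof.
rewrite /ctr scalerA mulrC -scalerA -scalerDr; congr (_ *: _).
rewrite scaler_sumr -big_split; apply: eq_bigr => i _ /=.
rewrite scaler_sumr -big_split; apply: eq_bigr => j _ /=.
by rewrite !hookP scalerDr scalerA mulrC -scalerA.
Qed.

Lemma ctr0 : ctr 0 = 0.
Proof. by have := ctrP (-1) 0 0; rewrite scaler0 addr0 scaleN1r addNr. Qed.

Lemma ctrZ k a : ctr (k *: a) = k *: ctr a.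
Proof. by rewrite -[k *: a]addr0 ctrP ctr0 addr0. Qed.

Lemma ctrD a b : ctr (a + b) = ctr a + ctr b.
Proof. by rewrite -[a]scale1r ctrP !scale1r. Qed.

(** Half of this trace is bot(Omega), which is half the dimension. *)
Lemma trace_invB :
  \sum_i \sum_j B i j * O [:: bvec i; bvec j] = (\dim {:V})%:R.
Proof.
rewrite -[in RHS](card_ord (\dim {:V})) -sum1_card natr_sum; apply: eq_bigr => i _.
have -> : 1 = - - bcoord i (bvec i) :> R by rewrite opprK bcoord_bvec eqxx.
rewrite -invB -sumrN.
by apply: eq_bigr => j _; rewrite (altO.1 [::] _ _ [::]) mulrN.
Qed.

Lemma contract_invB i :
  \sum_j B i j *: hook (bvec j) O = - covector (bcoord i).
Proof.
apply/funext => v; rewrite fct_sumE lformE.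
case: v => [|x [|y v]] /=; last 1 first.
- by rewrite oppr0 big1 // => j _; rewrite lformE [hook _ _ _]homO // mulr0.
- by rewrite oppr0 big1 // => j _; rewrite lformE [hook _ _ _]homO // mulr0.
exact: invB.
Qed.

(** On k-forms of a 2m-dimensional space, [bot, Omega /\ _] = m - k. Two
    applications of the antiderivation rule to i_(e_j) i_(e_i) (Omega /\ a)
    give four terms: Omega /\ bot a, the trace of B against Omega, and two mixed
    terms. The sums sum_j B_ij i_(e_j) Omega are minus the dual basis, so that
    each mixed term is the Euler operator. *)
Lemma lefschetz_comm a v : lalt a ->
  ctr (L a) v = L (ctr a) v + ((\dim {:V})%:R / 2%:R - (size v)%:R) * a v.
Proof.
move=> alta.
(* the Euler operator applied to a *)
pose E : lform V R := \sum_i shuffle (covector (bcoord i)) (hook (bvec i) a).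
have sO : signed O = O by rewrite (homog_signed homO) expr0 scale1r.
have hookL i j : hook (bvec j) (hook (bvec i) (L a)) =
    O [:: bvec i; bvec j] *: a - shuffle (hook (bvec i) O) (hook (bvec j) a)
    + shuffle (hook (bvec j) O) (hook (bvec i) a)
    + L (hook (bvec j) (hook (bvec i) a)).
  rewrite hook_shuffle sO hookD !hook_shuffle sO.
  rewrite (homog_signed (homog_hook _ homO)) expr1 scaleN1r.
  rewrite shuffleNl shuffle_homog0; first by rewrite !addrA.
  exact/homog_hook/homog_hook.
have S1 : \sum_i \sum_j B i j *: (O [:: bvec i; bvec j] *: a) = (\dim {:V})%:R *: a.
  rewrite -trace_invB scaler_suml; apply: eq_bigr => i _.
  by rewrite scaler_suml; apply: eq_bigr => j _; rewrite scalerA.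
have S3 : \sum_i \sum_j B i j *: shuffle (hook (bvec j) O) (hook (bvec i) a) = - E.
  rewrite -sumrN; apply: eq_bigr => i _.
  rewrite -shuffleNl -contract_invB shuffle_suml; apply: eq_bigr => j _.
  by rewrite shuffleZl.
have S2 : \sum_i \sum_j B i j *: shuffle (hook (bvec i) O) (hook (bvec j) a) = E.
  rewrite -[RHS]opprK -S3 exchange_big -sumrN; apply: eq_bigr => i _ /=.
  by rewrite -sumrN; apply: eq_bigr => j _; rewrite skewB scaleNr.
have -> : ctr (L a) = L (ctr a) + 2%:R^-1 *: ((\dim {:V})%:R *: a - E - E).
  have S4 : L (ctr a) = 2%:R^-1 *:
      \sum_i \sum_j B i j *: L (hook (bvec j) (hook (bvec i) a)).
    rewrite /ctr shuffleZr shuffle_sumr; congr (_ *: _); apply: eq_bigr => i _.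
    by rewrite shuffle_sumr; apply: eq_bigr => j _; rewrite shuffleZr.
  rewrite S4 -S1 -{1}S2 -S3 -scalerDr addrC -!sumrN -!big_split /=.
  congr (_ *: _); apply: eq_bigr => i _.
  rewrite -!sumrN -!big_split /=; apply: eq_bigr => j _.
  by rewrite hookL !scalerDr scalerN.
rewrite lformD lformZ !lformD !lformN lformZ [E v]euler //.
by field.
Qed.

End Lefschetz.

(** * Four-forms and six-forms in dimension six *)
Section Dim6.
Variables (R : numFieldType) (V : vectType R).
Hypothesis dimV : \dim {:V} = 6%N.
Variables (O : lform V R) (B : 'I_(\dim {:V}) -> 'I_(\dim {:V}) -> R).
Hypotheses (altO : lalt O) (homO : homog 2 O).
Hypothesis (skewB : forall i j, B j i = - B i j).
Hypothesis (invB : forall i x, \sum_j B i j * O [:: bvec j; x] = - bcoord i x).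
Implicit Types (a b c : lform V R) (x y : V) (u v w : seq V).

Local Notation L := (shuffle O).
Local Notation D := (ctr B).

Lemma lefschetz_homog (k : nat) (r : R) a :
  lalt a -> homog k a -> 3%:R - k%:R = r ->
  D (L a) = r *: a + L (D a).
Proof.
move=> alta ka <-; apply/funext => v.
rewrite (lefschetz_comm altO homO skewB invB) // lformD lformZ dimV addrC.
have [<-|/ka ->] := eqVneq (size v) k; last by rewrite !mulr0.
by congr (_ * _ + _); field.
Qed.

(** Moving the three contractions past Omega with the weights -1, 1, 3 of
    forms of degree 4, 2, 0. *)
Lemma ctr3_L a : lalt a -> homog 4 a -> D (D (D (L a))) [::] = 3%:R * D (D a) [::].
Proof.
move=> alta a4.
have altDa := lalt_ctr B alta; have Da2 := homog_ctr B a4.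
have DLa : D (L a) = (- 1) *: a + L (D a).
  by apply: (lefschetz_homog alta a4); ring.
have DLDa : D (L (D a)) = 1 *: D a + L (D (D a)).
  by apply: (lefschetz_homog altDa Da2); ring.
have DLDDa : D (L (D (D a))) = 3%:R *: D (D a) + L (D (D (D a))).
  by apply: (lefschetz_homog (lalt_ctr B altDa) (homog_ctr B Da2)); ring.
rewrite DLa !ctrP. rewrite DLDa !ctrP DLDDa !lformE /=.
by rewrite [O [::]]homO // mul0r; ring.
Qed.

Lemma ctr_O : D O [::] = 3%:R.
Proof.
rewrite /ctr lformZ fct_sumE.
under eq_bigr do rewrite fct_sumE.
rewrite (trace_invB altO invB) dimV; by field.
Qed.

(** In particular the volume form is not zero. *)
Lemma ctr3_O3 : D (D (D (L (L O)))) [::] = 36%:R.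
Proof.
have altL := lalt_shuffle altO altO; have L4 := homog_shuffle homO homO.
rewrite ctr3_L //.
have -> : D (L O) = 1 *: O + L (D O) by apply: (lefschetz_homog altO homO); ring.
rewrite (shuffle_homogC homO (homog_ctr B homO)) expr0.
rewrite (shuffle_homog0 _ (homog_ctr B homO)) scalerA -scalerDl ctrZ lformZ ctr_O.
by ring.
Qed.

(** The line of 6-forms is spanned by Omega^3. Indeed Omega /\ a = 0 by degree,
    so the commutation relation gives Omega /\ bot a = 3 a, then
    Omega /\ bot^2 a = 4 bot a and Omega /\ bot^3 a = 3 bot^2 a, whence
    36 a = (bot^3 a) Omega^3. *)
Lemma top_form a : lalt a -> homog 6 a ->
  a = (D (D (D a)) [::] / 36%:R) *: L (L O).
Proof.
move=> alta a6.
have altDa := lalt_ctr B alta; have Da4 := homog_ctr B a6.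
have altDDa := lalt_ctr B altDa; have DDa2 := homog_ctr B Da4.
have DDDa0 := homog_ctr B DDa2.
have La : L a = 0.
  apply/funext => v; have [v6|v6] := ltnP 6%N (size v).
    by apply: lalt_above_dim; [exact: lalt_shuffle|rewrite dimV].
  apply: (homog_shuffle homO a6); rewrite -[(2 + 6)%N]/8%N.
  by apply: contraTneq v6 => ->.
have LDa : L (D a) = 3%:R *: a.
  have E : D (L a) = (- 3%:R) *: a + L (D a).
    by apply: (lefschetz_homog alta a6); ring.
  by move: E; rewrite La ctr0 scaleNr => /esym/eqP; rewrite addrC subr_eq0 => /eqP.
have LDDa : L (D (D a)) = 4%:R *: D a.
  have E : D (L (D a)) = (- 1) *: D a + L (D (D a)).
    by apply: (lefschetz_homog altDa Da4); ring.
  move: E; rewrite LDa ctrZ => /eqP; rewrite addrC -subr_eq => /eqP <-.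
  by rewrite -scalerBl; congr (_ *: _); ring.
have LDDDa : L (D (D (D a))) = 3%:R *: D (D a).
  have E : D (L (D (D a))) = 1 *: D (D a) + L (D (D (D a))).
    by apply: (lefschetz_homog altDDa DDa2); ring.
  move: E; rewrite LDDa ctrZ => /eqP; rewrite addrC -subr_eq => /eqP <-.
  by rewrite -scalerBl; congr (_ *: _); ring.
have LDDDa' : L (D (D (D a))) = D (D (D a)) [::] *: O.
  by rewrite (shuffle_homogC homO DDDa0) expr0 scale1r shuffle_homog0.
have E : 36%:R *: a = D (D (D a)) [::] *: L (L O).
  rewrite -!shuffleZr -LDDDa' LDDDa !(shuffleZr 3%:R) LDDa (shuffleZr 4%:R) LDa.
  rewrite !scalerA.
  by congr (_ *: _); ring.
by rewrite mulrC -scalerA -E scalerA mulVf ?scale1r // pnatr_eq0.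
Qed.

End Dim6.

(** * Antisymmetrization and the shuffle product *)

(** Sorting the permutations of n.+1 indices by the index sent to i0. *)
Lemma lift_perm_bij n (i0 : 'I_n.+1) :
  bijective (fun p : 'I_n.+1 * 'S_n => lift_perm p.1 i0 p.2).
Proof.
apply: inj_card_bij; last by rewrite card_prod !card_Sn card_ord factS.
move=> [j s] [k t] /= E.
have jk : j = k.
  by apply: (@perm_inj _ (lift_perm k i0 t)); rewrite -[in LHS]E !lift_perm_id.
subst k; congr (_, _); apply/permP => i; apply: (@lift_inj _ i0).
by rewrite -!(lift_perm_lift j) E.
Qed.

Section PermSum.
Variables (R : comNzRingType) (V : Type).
Implicit Types (a b c T : lform V R) (x y : V) (u v w : seq V).

Definition perm_sum n T (f : 'I_n -> V) : R :=
  \sum_(s : 'S_n) (-1) ^+ s * T [seq f (s i) | i <- enum 'I_n].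

Definition insert x j u := take j u ++ x :: drop j u.

Definition tens k a b : lform V R := fun u => a (take k u) * b (drop k u).

Lemma map_lift_perm n (f : 'I_n.+1 -> V) j (t : 'S_n) :
  [seq f (lift_perm j ord0 t i) | i <- enum 'I_n.+1] =
  insert (f ord0) j [seq f (lift ord0 (t i)) | i <- enum 'I_n].
Proof.
have nj : (j <= n)%N by rewrite -ltnS.
have st : size (take j [seq f (lift ord0 (t i)) | i <- enum 'I_n]) = j.
  by rewrite size_takel // size_map size_enum_ord.
apply: (@eq_from_nth _ (f ord0)) => [|i].
  rewrite size_map size_enum_ord /insert size_cat st /= size_drop size_map.
  by rewrite size_enum_ord addnS subnKC.
rewrite size_map size_enum_ord => ni; rewrite /insert nth_cat st.
rewrite (nth_map ord0) ?size_enum_ord // -[i]/(val (Ordinal ni)) nth_ord_enum.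
case: (unliftP j (Ordinal ni)) => [i'|] -> /=; last first.
  by rewrite lift_perm_id ltnn subnn.
rewrite lift_perm_lift /bump; have [ji|ij] := leqP j i'.
  rewrite add1n ltnNge leqW // subSn //= nth_drop subnKC //.
  by rewrite (nth_map i') ?size_enum_ord // nth_ord_enum.
by rewrite add0n ij nth_take // (nth_map i') ?size_enum_ord // nth_ord_enum.
Qed.

(** Permutations are sorted by the position at which the first argument lands;
    landing at position j costs the sign (-1)^j. *)
Lemma perm_sum_rec n T (f : 'I_n.+1 -> V) :
  perm_sum T f = \sum_(j < n.+1) (-1) ^+ j *
    perm_sum (fun u => T (insert (f ord0) j u)) (fun i => f (lift ord0 i)).
Proof.
rewrite /perm_sum (reindex _ (onW_bij _ (lift_perm_bij ord0))) /=.
rewrite -(pair_bigA _ (fun j t => (-1) ^+ lift_perm j ord0 t *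
  T [seq f (lift_perm j ord0 t i) | i <- enum 'I_n.+1])) /=.
apply: eq_bigr => j _; rewrite mulr_sumr; apply: eq_bigr => t _.
rewrite map_lift_perm odd_lift_perm mulrA; congr (_ * _).
by rewrite addbF signr_addb signr_odd.
Qed.

Lemma eq_perm_sum n T T' (f : 'I_n -> V) :
  (forall u, size u = n -> T u = T' u) -> perm_sum T f = perm_sum T' f.
Proof.
by move=> TT'; apply: eq_bigr => s _; rewrite TT' // size_map size_enum_ord.
Qed.

Lemma perm_sumZ n k T (f : 'I_n -> V) :
  perm_sum (k *: T) f = k * perm_sum T f.
Proof. by rewrite mulr_sumr; apply: eq_bigr => s _; rewrite lformZ mulrCA. Qed.

Lemma antisym_insert x j a u : antisym a -> (j <= size u)%N ->
  a (insert x j u) = (-1) ^+ j * hook x a u.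
Proof.
move=> sa ju; rewrite /insert -[take j u ++ _]/([::] ++ take j u ++ _).
by rewrite antisym_move // size_takel //= cat_take_drop.
Qed.

Lemma antisym_hook x a : antisym a -> antisym (hook x a).
Proof. by move=> sa u y z w; apply: (sa (x :: u)). Qed.

Lemma tens_insert_left k x j a b u : antisym a -> (j <= k)%N -> (k <= size u)%N ->
  tens k.+1 a b (insert x j u) = (-1) ^+ j * tens k (hook x a) b u.
Proof.
move=> sa jk ku; have ju := leq_trans jk ku; rewrite /tens mulrA; congr (_ * b _).
  rewrite -antisym_insert //; last by rewrite size_takel.
  congr (a _); rewrite /insert take_cat size_takel // ltnNge leqW //= subSn //=.
  by rewrite take_takel // take_drop subnK.
rewrite /insert drop_cat size_takel // ltnNge leqW //= subSn //=.
by rewrite drop_drop subnK.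
Qed.

Lemma tens_insert_right k x j a b u : antisym b -> (k <= j)%N -> (j <= size u)%N ->
  tens k a b (insert x j u) = (-1) ^+ (j - k) * tens k a (hook x b) u.
Proof.
move=> sb kj ju; have ku := leq_trans kj ju; rewrite /tens mulrCA; congr (a _ * _).
  rewrite /insert take_cat size_takel //; case: ltnP => [_|jk].
    by rewrite take_takel.
  have -> : j = k by apply/eqP; rewrite eqn_leq jk.
  by rewrite subnn take0 cats0.
rewrite -antisym_insert //; last by rewrite size_drop leq_sub2r.
congr (b _); rewrite /insert drop_cat size_takel //.
rewrite drop_drop subnK // take_drop subnK //.
case: ltnP => [//|jk]; have -> : j = k by apply/eqP; rewrite eqn_leq jk.
by rewrite subnn drop0 [drop k (take k u)]drop_oversize ?size_takel.
Qed.

(** Antisymmetrizing a tensor product obeys the recursion of [shuffle]: the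
    first argument is absorbed by one of the k slots of a, all giving the same
    contribution, or by one of the l slots of b. These multiplicities build up
    the factor k! l!. *)
Lemma perm_sum_tens n k l a b (f : 'I_n -> V) :
    n = (k + l)%N -> antisym a -> antisym b -> homog k a -> homog l b ->
  perm_sum (tens k a b) f =
    (k`! * l`!)%:R * shuffle a b [seq f i | i <- enum 'I_n].
Proof.
elim: n k l a b f => [|n IH] k l a b f nkl sa sb ka lb.
  have [-> ->] : k = 0%N /\ l = 0%N.
    by move: nkl; case: k {ka} => [|k] //; case: l {lb}.
  have e0 : enum 'I_0 = [::] by apply: size0nil; rewrite size_enum_ord.
  rewrite /perm_sum (big_pred1 1%g) => [|s]; last by apply/esym/eqP/permS0.
  by rewrite odd_perm1 e0 /= expr0 !mul1r.
rewrite perm_sum_rec enum_ordSl /=; set x := f ord0.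
rewrite -map_comp; set g := fun i => f (lift ord0 i); rewrite -[_ \o _]/g.
pose P := perm_sum (tens k.-1 (hook x a) b) g.
pose Q := (-1) ^+ k * perm_sum (tens k a (hook x b)) g.
transitivity (P *+ k + Q *+ l).
  transitivity (\sum_(j < n.+1) if (j < k)%N then P else Q).
    apply: eq_bigr => j _; have nj : (j <= n)%N by rewrite -ltnS.
    case: ifP => jk.
      case: k jk {ka Q} nkl @P => // k jk nkl P.
      rewrite (eq_perm_sum (T' := (-1) ^+ j *: tens k (hook x a) b)) => [|u un].
        by rewrite perm_sumZ mulrA -expr2 sqrr_sign mul1r.
      by apply: tens_insert_left => //; rewrite un; move: nkl; lia.
    have kj : (k <= j)%N by rewrite leqNgt jk.
    rewrite (eq_perm_sum (T' := (-1) ^+ (j - k) *: tens k a (hook x b))) => [|u un].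
      rewrite perm_sumZ mulrA -[in (-1) ^+ j](subnK kj) exprD [X in X * _]mulrAC.
      by rewrite -expr2 sqrr_sign mul1r.
    by apply: tens_insert_right => //; rewrite un.
  rewrite -(big_mkord xpredT (fun j => if (j < k)%N then P else Q)) nkl.
  rewrite big_mkord big_split_ord /=; congr (_ + _).
    by under eq_bigr => i _ do rewrite ltn_ord; rewrite sumr_const card_ord.
  under eq_bigr => i _ do rewrite ltnNge leq_addr /=.
  by rewrite sumr_const card_ord.
rewrite (homog_signed ka) shuffleZl lformZ signr_odd mulrDr; congr (_ + _).
  case: k ka nkl @P {Q} => [|k] ka nkl P.
    by rewrite hook_homog0 // shuffle0l [X in _ = _ * X]/0 mulr0.
  rewrite /P (IH k l) //; [|by case: nkl|exact: antisym_hook|exact: homog_hook].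
  by rewrite -[_ *+ k.+1]mulr_natl mulrA -natrM mulnA.
case: l lb nkl => [|l] lb nkl.
  by rewrite hook_homog0 // shuffle0r [X in _ = _ * (_ * X)]/0 !mulr0.
have nkl' : n = (k + l)%N by move: nkl; rewrite addnS => -[].
rewrite /Q (IH k l) //; [|exact: antisym_hook|exact: homog_hook].
by rewrite -[_ *+ l.+1]mulr_natl factS !natrM; ring.
Qed.

End PermSum.

(** * From forms on tuples to functions on lists *)
Section OfKform.
Variables (R : realType) (V : vectType R).
Implicit Types (x y : V) (u v w : seq V).

Definition lform_of k (a : kform R V k) : lform V R :=
  fun s => oapp a 0 (insub s).

Lemma lform_ofE k (a : kform R V k) (t : k.-tuple V) : lform_of a t = a t.
Proof. by rewrite /lform_of valK. Qed.

Lemma homog_lform_of k (a : kform R V k) : homog k (lform_of a).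
Proof. by move=> v nv; rewrite /lform_of insubN. Qed.

Lemma eq_lform k (a b : lform V R) : homog k a -> homog k b ->
  (forall t : k.-tuple V, a t = b t) -> a = b.
Proof.
move=> ka kb ab; apply/funext => v.
have [vk|nv] := boolP (size v == k); first exact: (ab (Tuple vk)).
by rewrite ka ?kb.
Qed.

Lemma lform_of_inter k x (a : kform R V k.+1) :
  lform_of (inter x a) = hook x (lform_of a).
Proof.
apply: eq_lform => [||t]; first exact: homog_lform_of.
  exact/homog_hook/homog_lform_of.
by rewrite lform_ofE /hook -[x :: t]/(tval [tuple of x :: t]) lform_ofE.
Qed.

Lemma lform_of_set k (a : kform R V k) u x w (uw : size (u ++ x :: w) == k)
    (i : 'I_k) y : val i = size u ->
  a (set_tnth (Tuple uw) i y) = lform_of a (u ++ y :: w).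
Proof.
move=> iu; have uyw : size (u ++ y :: w) == k by move: uw; rewrite !size_cat.
rewrite -[u ++ y :: w]/(tval (Tuple uyw)) lform_ofE; congr a.
apply: eq_from_tnth => j; rewrite tnth_mktuple !(tnth_nth x) /= !nth_cat.
rewrite -val_eqE /= iu; have [uj|ju|->] := ltngtP j (size u) => //.
  by rewrite -(subnSK ju).
by rewrite subnn.
Qed.

Lemma lalt_lform_of k (a : kform R V k) : altform a -> lalt (lform_of a).
Proof.
move=> [ma aa].
have ml : mlinear (lform_of a).
  move=> u c x y w.
  have [uw|nuw] := boolP (size (u ++ x :: w) == k); last first.
    by rewrite !homog_lform_of ?mulr0 ?addr0 //; move: nuw; rewrite !size_cat.
  have uk : (size u < k)%N by rewrite -(eqP uw) size_cat /= addnS ltnS leq_addr.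
  by rewrite -!(lform_of_set a uw (i := Ordinal uk)) // ma.
split=> // u.
have sq x w : lform_of a (u ++ x :: x :: w) = 0.
  have [uw|nuw] := boolP (size (u ++ x :: x :: w) == k); last first.
    exact: homog_lform_of.
  have uk : ((size u).+1 < k)%N.
    by rewrite -(eqP uw) size_cat /= !addnS !ltnS leq_addr.
  rewrite -[u ++ _]/(tval (Tuple uw)) lform_ofE.
  apply: (aa _ (Ordinal (ltnW uk)) (Ordinal uk)).
    by rewrite -val_eqE /= neq_ltn ltnSn.
  by rewrite !(tnth_nth x) /= !nth_cat ltnn subnn ltnNge leqnSn /= subSnn.
move=> x y w; apply/eqP; rewrite -addr_eq0; apply/eqP.
have := sq (1 *: x + y) w; rewrite ml -(cat_rcons x) -(cat_rcons y u) !ml.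
rewrite !cat_rcons !sq.
by rewrite !mul1r add0r addr0.
Qed.

Lemma lform_of_wedge k l (a : kform R V k) (b : kform R V l) :
  antisym (lform_of a) -> antisym (lform_of b) ->
  lform_of (wedge a b) = shuffle (lform_of a) (lform_of b).
Proof.
move=> sa sb; apply: eq_lform => [||t]; first exact: homog_lform_of.
  by apply: homog_shuffle; exact: homog_lform_of.
have := perm_sum_tens (tnth t) (erefl (k + l)%N) sa sb
  (homog_lform_of a) (homog_lform_of b).
rewrite map_tnth_enum lform_ofE => perm_ab.
have kl0 : (k`! * l`!)%:R != 0 :> R by rewrite pnatr_eq0 -lt0n muln_gt0 !fact_gt0.
rewrite /wedge -[RHS](mulKf kl0) -perm_ab; congr (_ * _).
apply: eq_bigr => s _; rewrite -mulrA; congr (_ * _).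
have map_take_drop (f : 'I_(k + l) -> V) :
    let fs := [seq f i | i <- enum 'I_(k + l)] in
    take k fs = [seq f (lshift l i) | i <- enum 'I_k] /\
    drop k fs = [seq f (rshift k i) | i <- enum 'I_l].
  have -> : enum 'I_(k + l) =
      map (lshift l) (enum 'I_k) ++ map (@rshift k l) (enum 'I_l).
    apply: (inj_map val_inj); rewrite map_cat -(map_comp val (lshift l)).
    rewrite -(map_comp val (@rshift k l)) val_enum_ord iotaD.
    congr (_ ++ _); first by rewrite -val_enum_ord.
    rewrite add0n -[in LHS](addn0 k) iotaDl -val_enum_ord.
    by rewrite -(map_comp (addn k) val).
  rewrite /= map_cat -(map_comp f (lshift l)) -(map_comp f (@rshift k l)).
  by rewrite take_size_cat ?drop_size_cat // size_map size_enum_ord.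
rewrite /tens; have [-> ->] := map_take_drop (fun i => tnth t (s i)).
by congr (_ * _); rewrite -lform_ofE.
Qed.

Lemma lform_of_inj k : injective (@lform_of k).
Proof. by move=> a b ab; apply/funext => t; rewrite -!lform_ofE ab. Qed.

Lemma lform_ofP k c (a b : kform R V k) :
  lform_of (c *: a + b) = c *: lform_of a + lform_of b.
Proof.
apply: eq_lform => [||t]; first exact: homog_lform_of.
  by apply: homogD; [apply: homogZ|]; apply: homog_lform_of.
by rewrite !lformE !lform_ofE.
Qed.

Lemma lform_of0 k : lform_of (0 : kform R V k) = 0.
Proof. by apply/funext => v; rewrite /lform_of; case: insub. Qed.

Lemma lform_ofZ k c (a : kform R V k) : lform_of (c *: a) = c *: lform_of a.
Proof. by rewrite -[c *: a]addr0 lform_ofP lform_of0 addr0. Qed.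

Lemma lform_ofN k (a : kform R V k) : lform_of (- a) = - lform_of a.
Proof. by rewrite -scaleN1r lform_ofZ scaleN1r. Qed.

Lemma lform_of_sum k (I : finType) (F : I -> kform R V k) :
  lform_of (\sum_i F i) = \sum_i lform_of (F i).
Proof.
apply: (big_morph (fun a => lform_of a)) => [a b|]; last exact: lform_of0.
by rewrite -[a]scale1r lform_ofP !scale1r.
Qed.

Lemma lform_of_form1 (xi : dualv R V) : lform_of (form1 xi) = covector xi.
Proof.
apply: (@eq_lform 1) => [|[|y [|z v]]|t] //; first exact: homog_lform_of.
by rewrite lform_ofE; case/tupleP: t => y t; rewrite (tuple0 t).
Qed.

Lemma lalt_covector (xi : dualv R V) : lalt (covector xi).
Proof.
split=> [[|y [|z u]] | [|z [|t u]] k x y [|z' w]] *;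
  rewrite /= ?oppr0 ?mulr0 ?addr0 //.
exact: linearP.
Qed.

Lemma linfunE (f : V -> R^o) : linear f -> linfun f =1 f.
Proof.
move=> lf x; pose g : {linear V -> R^o} :=
  HB.pack f (GRing.isLinear.Build _ _ _ _ _ lf).
exact: (lfunE g).
Qed.

Lemma dual_basisE i x : dual_basis i x = bcoord i x.
Proof. by rewrite /dual_basis lfunE. Qed.

Lemma dual_expand (xi : dualv R V) :
  xi = \sum_i xi (bvec i) *: dual_basis i.
Proof.
apply/lfunP => x; rewrite sum_lfunE {1}(bvec_expand x) linear_sum.
apply: eq_bigr => i _; rewrite scale_lfunE dual_basisE linearZ /=.
exact: mulrC.
Qed.

End OfKform.

(** * The bivector of a symplectic form *)
Section SymplecticForm.
Variables (R : realType) (V : vectType R) (Omega : kform R V 2).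
Hypothesis symplO : symplectic Omega.
Implicit Types (x y : V) (u v w : seq V).

Local Notation O := (lform_of Omega).

Lemma lalt_Omega : lalt O. Proof. exact: lalt_lform_of symplO.1. Qed.

Lemma OmegaC x y : O [:: x; y] = - O [:: y; x].
Proof. exact: (lalt_Omega.1 [::] x y [::]). Qed.

Lemma OmegaE x y : Omega [tuple x; y] = O [:: x; y].
Proof. by rewrite -lform_ofE. Qed.

Lemma GammaE x y : Gamma Omega x y = O [:: x; y].
Proof.
have E z : inter x Omega [tuple z] = O [:: x; z].
  by rewrite -lform_ofE lform_of_inter.
rewrite /Gamma linfunE ?E // => c s t; rewrite !E; exact: (lalt_Omega.2 [:: x]).
Qed.

Lemma covector_Gamma x : covector (Gamma Omega x) = hook x O.
Proof.
apply: (@eq_lform _ _ 1) => [[|y [|z v]]||t] //.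
  exact/homog_hook/homog_lform_of.
case/tupleP: t => y t; rewrite (tuple0 t); exact: GammaE.
Qed.

Definition Omega_mx : 'M[R]_(\dim {:V}) :=
  \matrix_(i, j) O [:: bvec i; bvec j].

Lemma Omega_expand x y : O [:: x; y] = \sum_j bcoord j y * O [:: x; bvec j].
Proof. by rewrite {1}(bvec_expand y) (lalt_sumv [:: x] [::] _ _ lalt_Omega). Qed.

Lemma Omega_mx_unit : Omega_mx \in unitmx.
Proof.
rewrite -row_free_unit; apply: inj_row_free => u uM0.
pose x := \sum_i u 0 i *: bvec i.
have x0 : x = 0.
  apply: symplO.2 => y; rewrite OmegaE Omega_expand big1 // => j _.
  rewrite (lalt_sumv [::] [:: bvec j] _ _ lalt_Omega) /=.
  have := congr1 (fun A : 'rV_ _ => A 0 j) uM0; rewrite !mxE => Ej.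
  rewrite [X in _ * X](_ : _ = 0) ?mulr0 //; apply: etrans Ej.
  by apply: eq_bigr => i _; rewrite mxE.
apply/rowP => i; rewrite mxE -(coord_sum_free (u 0) i (basis_free (vbasisP {:V}))).
by rewrite -[\sum_i _]/x x0 linear0.
Qed.

Lemma Omega_mx_skew : Omega_mx^T = - Omega_mx.
Proof. by apply/matrixP => i j; rewrite !mxE; apply: OmegaC. Qed.

(** The matrix identity N M = -1, read as the statement that the sums
    sum_j N_ij i_(e_j) Omega are minus the dual basis. *)
Lemma inv_Omega_mx (N : 'M_(\dim {:V})) i x : N *m Omega_mx = - 1%:M ->
  \sum_j N i j * O [:: bvec j; x] = - bcoord i x.
Proof.
move=> NM; under eq_bigr do rewrite Omega_expand mulr_sumr.
rewrite exchange_big (bigD1 i) //= [X in _ + X]big1 ?addr0 => [|k /negPf ki].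
  have := congr1 (fun A : 'M_(_) => A i i) NM; rewrite !mxE eqxx => E.
  rewrite -[RHS]mulrN1 -E mulr_sumr; apply: eq_bigr => j _.
  by rewrite mxE mulrCA.
have := congr1 (fun A : 'M_(_) => A i k) NM; rewrite !mxE eq_sym ki oppr0 => E.
transitivity (bcoord k x * \sum_j N i j * Omega_mx j k); last by rewrite E mulr0.
rewrite mulr_sumr; apply: eq_bigr => j _.
by rewrite mxE mulrCA.
Qed.

Lemma flip_GammaE x y : linfun (fun z => Gamma Omega z x : R^o) y = O [:: y; x].
Proof.
rewrite linfunE ?GammaE // => c s t; rewrite !GammaE; exact: (lalt_Omega.2 [::]).
Qed.

(** With M the matrix of Omega, the image under Gamma of the bivector of matrix N
    is M^T N M = - M N M; it equals M for N = - M^-1. *)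
Definition inverse_bivector : kform R (dualv R V) 2 := fun xi =>
  \sum_i \sum_j (- invmx Omega_mx) i j *
    (tnth xi ord0 (bvec i) * tnth xi ord_max (bvec j)).

Lemma ord2P (i : 'I_2) : i = ord0 \/ i = ord_max.
Proof. by case: i => [[|[|//]]] ?; [left|right]; apply: val_inj. Qed.

Lemma altform_inverse_bivector : altform inverse_bivector.
Proof.
split=> [v i c x y | v i j ij vij]; rewrite /inverse_bivector.
  rewrite mulr_sumr -big_split; apply: eq_bigr => k _ /=.
  rewrite mulr_sumr -big_split; apply: eq_bigr => l _ /=.
  by case: (ord2P i) => ->; rewrite !tnth_mktuple /= add_lfunE scale_lfunE;
    rewrite -[_ *: _]/(c * _) /=; ring.
have v01 : tnth v ord_max = tnth v ord0.
  by move: ij vij; case: (ord2P i) (ord2P j) => [->|->] [->|->].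
rewrite v01; set xi := tnth v ord0; set S := \sum_i _.
have N_skew : (invmx Omega_mx)^T = - invmx Omega_mx.
  rewrite trmx_inv Omega_mx_skew -scaleN1r invmxZ ?scaleN1r ?invrN1 ?scaleN1r //.
  by rewrite -Omega_mx_skew unitmx_tr Omega_mx_unit.
have SN : S = - S.
  rewrite [in LHS]/S exchange_big -sumrN; apply: eq_bigr => k _ /=.
  rewrite -sumrN; apply: eq_bigr => l _.
  have -> : (- invmx Omega_mx) l k = invmx Omega_mx k l.
    have := congr1 (fun A : 'M_(_) => A k l) N_skew.
    by rewrite !mxE => ->; rewrite opprK.
  by rewrite mxE mulNr opprK [xi _ * _]mulrC.
move/eqP: SN; rewrite -addr_eq0 -mulr2n -mulr_natr mulf_eq0 pnatr_eq0 orbF.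
by move/eqP.
Qed.

Lemma inverse_bivectorP : bivector_image (Gamma Omega) inverse_bivector = Omega.
Proof.
apply/funext => t; case/tupleP: t => x t; case/tupleP: t => y t; rewrite (tuple0 t).
rewrite /bivector_image /inverse_bivector !tnth_mktuple.
rewrite -[tnth _ ord0]/x -[tnth _ ord_max]/y.
under eq_bigr => i _.
  under eq_bigr do rewrite !flip_GammaE mulrCA.
  rewrite -mulr_sumr inv_Omega_mx; last by rewrite mulNmx mulVmx ?Omega_mx_unit.
  rewrite mulrN; over.
rewrite sumrN; under eq_bigr do rewrite mulrC.
rewrite -(lalt_sumv [::] [:: x] _ _ lalt_Omega) -bvec_expand.
by rewrite -OmegaC -OmegaE; congr Omega; apply: val_inj.
Qed.

Lemma X_OmegaP : altform (X_Omega Omega) /\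
  bivector_image (Gamma Omega) (X_Omega Omega) = Omega.
Proof.
apply: (@xgetPex _ 0 [set B | altform B /\
  bivector_image (Gamma Omega) B = Omega]%classic).
by exists inverse_bivector; split;
  [exact: altform_inverse_bivector|exact: inverse_bivectorP].
Qed.

Definition X_Omega_coef (i j : 'I_(\dim {:V})) : R :=
  X_Omega Omega [tuple dual_basis i; dual_basis j].

Lemma X_Omega_coefC i j : X_Omega_coef j i = - X_Omega_coef i j.
Proof.
have [altB _] := X_OmegaP; have [sB _] := lalt_lform_of altB.
by rewrite /X_Omega_coef -!lform_ofE; apply: (sB [::] _ _ [::]).
Qed.

(** The bivector N is pinned down by its image: evaluated on basis vectors,
    that image is M^T N M, where M^T = - M, and equals M, so that N M = -1. *)
Lemma X_Omega_coef_inv i x :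
  \sum_j X_Omega_coef i j * O [:: bvec j; x] = - bcoord i x.
Proof.
pose N : 'M[R]_(\dim {:V}) := \matrix_(i, j) X_Omega_coef i j.
have [altB imB] := X_OmegaP; have lB := lalt_lform_of altB.
have MNM : Omega_mx = Omega_mx^T *m (N *m Omega_mx).
  apply/matrixP => k l; rewrite !mxE -OmegaE -[in LHS]imB /bivector_image.
  rewrite -lform_ofE /=.
  have -> : enum 'I_2 = [:: ord0; ord_max].
    by rewrite enum_ordSl enum_ordSl enum_ord0 /=; congr [:: _; _]; apply: val_inj.
  rewrite /= -[tnth _ ord0]/(bvec k) -[tnth _ ord_max]/(bvec l).
  rewrite [X in [:: X; _]]dual_expand [X in [:: _; X]]dual_expand.
  rewrite (lalt_sumv [::] _ _ _ lB); apply: eq_bigr => a _.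
  rewrite flip_GammaE !mxE; congr (_ * _).
  rewrite (lalt_sumv [:: _] [::] _ _ lB); apply: eq_bigr => b _.
  by rewrite flip_GammaE !mxE mulrC /X_Omega_coef -lform_ofE.
have NM : N *m Omega_mx = - 1%:M.
  have : Omega_mx *m (N *m Omega_mx) = Omega_mx *m (- 1%:M).
    by rewrite mulmxN mulmx1 [in RHS]MNM Omega_mx_skew mulNmx opprK.
  by move/(congr1 (mulmx (invmx Omega_mx))); rewrite !mulKmx ?Omega_mx_unit.
rewrite -(inv_Omega_mx i x NM); apply: eq_bigr => j _; by rewrite mxE.
Qed.

Lemma lform_of_bot k (a : kform R V k.+2) :
  lform_of (bot Omega a) = ctr X_Omega_coef (lform_of a).
Proof.
rewrite /bot /contract lform_ofZ lform_of_sum; congr (_ *: _).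
apply: eq_bigr => i _; rewrite lform_of_sum; apply: eq_bigr => j _.
by rewrite lform_ofZ !lform_of_inter.
Qed.

End SymplecticForm.

(** * The endomorphism and the quadratic form of an effective 3-form *)
Section EffectiveForm.
Variables (R : realType) (V : vectType R).
Variables (Omega : kform R V 2) (omega : kform R V 3).
Hypotheses (dimV : \dim {:V} = 6%N) (symplO : symplectic Omega).
Hypothesis (alto : altform omega).
Implicit Types (x y : V) (u v w : seq V).

Local Notation O := (lform_of Omega).
Local Notation W := (lform_of omega).
Local Notation D := (ctr (X_Omega_coef Omega)).
Local Notation L := (shuffle O).

Let altO : lalt O := lalt_Omega symplO.
Let altW : lalt W := lalt_lform_of alto.
Let homO : homog 2 O := homog_lform_of Omega.
Let homW : homog 3 W := homog_lform_of omega.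
Let skewB := X_Omega_coefC symplO.
Let invB := X_Omega_coef_inv symplO.

Lemma lform_of_volume : lform_of (volume Omega) = - (6%:R^-1 *: L (L O)).
Proof.
have O2 : lform_of (wedge Omega Omega) = L O.
  exact: (@lform_of_wedge _ _ 2 2 _ _ altO.1 altO.1).
rewrite /volume lform_ofN lform_ofZ (@lform_of_wedge _ _ 2 4) ?O2 //.
  exact: altO.1.
exact: (lalt_shuffle altO altO).1.
Qed.

Lemma lform_of_inter_wedge x :
  lform_of (wedge (inter x omega) omega) = shuffle (hook x W) W.
Proof.
rewrite (@lform_of_wedge _ _ 2 3) ?lform_of_inter //; last exact: altW.1.
exact: (lalt_hook x altW).1.
Qed.

(** Existence of the vector A(sigma): each e^i /\ sigma is a multiple of
    Omega^3, because Omega^3 spans the 6-forms, and these multiples are the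
    coordinates of the vector up to the factor -6 by which the volume form
    -Omega^3 / 6 is normalized. *)
Lemma A_coefP (sigma : kform R V 5) (eta : dualv R V) : lalt (lform_of sigma) ->
  shuffle (covector eta) (lform_of sigma) =
  - (eta (A_coef (volume Omega) sigma) / 6%:R) *: L (L O).
Proof.
move=> altS.
suff AP : forall eta : dualv R V, wedge (form1 eta) sigma =
    eta (A_coef (volume Omega) sigma) *: volume Omega.
  rewrite -lform_of_form1 -(@lform_of_wedge _ _ 1 5); first last.
  - exact: altS.1.
  - by rewrite lform_of_form1; apply: (lalt_covector eta).1.
  by rewrite AP lform_ofZ lform_of_volume scalerN scalerA scaleNr.
apply: (@xgetPex _ 0 [set Z : V | forall eta : dualv R V,
  wedge (form1 eta) sigma = eta Z *: volume Omega]%classic).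
move=> {eta}; pose tau i := shuffle (covector (bcoord i)) (lform_of sigma).
have tauE i : exists c, tau i = c *: L (L O).
  eexists; apply: (top_form dimV altO homO skewB invB).
    apply: lalt_shuffle => //; rewrite -[bcoord i](funext (dual_basisE i)).
    exact: lalt_covector.
  apply: (@homog_shuffle _ _ 1 5); last exact: homog_lform_of.
  by move=> [|x [|y v]].
have [c cE] := choice tauE.
(* -6 undoes the normalization of the volume form *)
exists (\sum_i (- 6%:R * c i) *: bvec i) => eta /=; apply: lform_of_inj.
rewrite (@lform_of_wedge _ _ 1 5); first last.
- exact: altS.1.
- by rewrite lform_of_form1; apply: (lalt_covector eta).1.
have -> : lform_of (form1 eta) = \sum_i eta (bvec i) *: covector (bcoord i).
  rewrite lform_of_form1; apply/funext => v; rewrite fct_sumE.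
  case: v => [|x [|y v]]; last 1 first.
  - by rewrite big1 // => i _; rewrite lformZ mulr0.
  - by rewrite big1 // => i _; rewrite lformZ mulr0.
  rewrite /= {1}(bvec_expand x) linear_sum; apply: eq_bigr => i _.
  by rewrite linearZ /= lformZ [RHS]mulrC.
rewrite shuffle_suml lform_ofZ lform_of_volume linear_sum scaler_suml.
apply: eq_bigr => i _; rewrite shuffleZl -/(tau i) cE.
rewrite scalerN !scalerA -scaleNr; congr (_ *: _).
rewrite [X in - (X / _)](_ : _ = - 6%:R * c i * eta (bvec i)); last exact: linearZ.
by field.
Qed.

Lemma LR_formE x : LR_form Omega omega x =
  - (4%:R^-1 * D (D (shuffle (hook x W) (hook x W))) [::]).
Proof.
rewrite /LR_form -lform_ofE !lform_of_bot.
rewrite (@lform_of_wedge _ _ 2 2) lform_of_inter //; exact: (lalt_hook x altW).1.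
Qed.

(** The 2-forms i_X omega and i_Y omega commute, so polarizing doubles the
    coefficient 1/4. *)
Lemma LR_polarE x y : LR_polar Omega omega x y =
  - (2%:R^-1 * D (D (shuffle (hook x W) (hook y W))) [::]).
Proof.
rewrite /LR_polar !LR_formE.
have -> : hook (x + y) W = hook x W + hook y W.
  by rewrite -[x]scale1r hook_linear // !scale1r.
have C : shuffle (hook y W) (hook x W) = shuffle (hook x W) (hook y W).
  by rewrite (@shuffle_homogC _ _ 2 2) ?expr0 ?scale1r //; apply: homog_hook.
by rewrite !shuffleDl !shuffleDr C !ctrD !lformD; field.
Qed.

Hypothesis effo : effective Omega omega.

(** The antiderivation i_Y applied to Omega /\ omega = 0. *)
Lemma effective_hook y : shuffle (hook y O) W = - L (hook y W).
Proof.
have LW : L W = 0.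
  rewrite (shuffle_homogC homO homW) expr0 scale1r.
  rewrite -(@lform_of_wedge _ _ 3 2); [|exact: altW.1|exact: altO.1].
  by rewrite [wedge _ _]effo lform_of0.
apply/eqP; rewrite -addr_eq0; apply/eqP.
have := hook_shuffle y O W; rewrite LW (homog_signed homO) expr0 scale1r.
exact: esym.
Qed.

End EffectiveForm.

Theorem proposition3p8 (R : realType) (V : vectType R) (dimV : \dim {:V} = 6%N)
    (Omega : kform R V 2) (symplO : symplectic Omega)
    (omega : kform R V 3) (alto : altform omega) (effo : effective Omega omega)
    (X Y : V) :
  Omega [tuple K_endo Omega omega X; Y] = LR_polar Omega omega X Y.
Proof.
have altO := lalt_Omega symplO; have homO := homog_lform_of Omega.
have altW := lalt_lform_of alto; have homW := homog_lform_of omega.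
have skewB := X_Omega_coefC symplO; have invB := X_Omega_coef_inv symplO.
have altA := lalt_hook X altW; have altB := lalt_hook Y altW.
have homA := homog_hook X homW; have homB := homog_hook Y homW.
rewrite (OmegaE Omega) (LR_polarE Omega alto); set Z := K_endo _ _ _.
have altS : lalt (lform_of (wedge (inter X omega) omega)).
  by rewrite (lform_of_inter_wedge alto); apply: lalt_shuffle.
(* Testing the definition of Z against the covector i_Y Omega brings in
   Omega(Y, Z) = - Omega(Z, Y). *)
have := A_coefP dimV symplO (Gamma Omega Y) altS; rewrite -[A_coef _ _]/Z.
rewrite (covector_Gamma symplO) (lform_of_inter_wedge alto) (GammaE symplO).
rewrite (OmegaC symplO) mulNr opprK.
(* i_Y Omega /\ i_X omega /\ omega = - Omega /\ i_X omega /\ i_Y omega *)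
rewrite (shuffleA (hook Y _)) (shuffle_homogC (homog_hook Y homO) homA).
rewrite expr0 scale1r -(shuffleA (hook X _)) (effective_hook symplO alto effo).
rewrite shuffleNr (shuffleA (hook X _)) (shuffle_homogC homA homO) expr0 scale1r.
rewrite -(shuffleA (lform_of Omega)) -scaleN1r => E.
(* Both sides are 6-forms: the triple contraction turns them into scalars. *)
have ctr3Z k a : ctr (X_Omega_coef Omega) (ctr (X_Omega_coef Omega)
    (ctr (X_Omega_coef Omega) (k *: a))) [::] =
    k * ctr (X_Omega_coef Omega) (ctr (X_Omega_coef Omega)
    (ctr (X_Omega_coef Omega) a)) [::].
  by rewrite !(ctrZ _ k).
have := congr1 (fun a => ctr (X_Omega_coef Omega) (ctr (X_Omega_coef Omega)
  (ctr (X_Omega_coef Omega) a)) [::]) E.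
rewrite !ctr3Z (ctr3_O3 dimV altO homO skewB invB).
rewrite (ctr3_L dimV altO homO skewB invB); last first.
- exact: (homog_shuffle homA homB).
- exact: lalt_shuffle.
set d := ctr _ _ _; set z := lform_of Omega _ => F.
have -> : z = (z / 6%:R * 36%:R) / 6%:R by field.
by rewrite -F; field.
Qed.
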